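(* Let $(G,\tau,\oplus)$ be a countable Hausdorff topological gyrogroup. Then $G$ has a closed suitable set which generates $G$; that is, there is a subset $S\subset G$ such that $S$ is discrete in the subspace topology, $S$ is closed in $G$, and $\langle S\rangle=G$.
   Context: A gyrogroup is a nonempty set $G$ with a binary operation $\oplus$ such that: (G1) there is a unique $0\in G$ with $0\oplus a=a=a\oplus 0$ for all $a\in G$; (G2) each $x\in G$ has a unique inverse $\ominus x\in G$ with $\ominus x\oplus x=0=x\oplus(\ominus x)$; (G3) there is a map $\mathrm{gyr}:G\times G\to \mathrm{Aut}(G,\oplus)$ (where $\mathrm{Aut}(G,\oplus)$ is the set of bijections $G\to G$ preserving $\oplus$) with $x\oplus(y\oplus z)=(x\oplus y)\oplus \mathrm{gyr}[x,y](z)$ for all $x,y,z\in G$; (G4) $\mathrm{gyr}[x\oplus y,y]=\mathrm{gyr}[x,y]$ for all $x,y\in G$. A topological gyrogroup $(G,\tau,\oplus)$ is a gyrogroup with a topology such that $\oplus:G\times G\to G$ is jointly continuous and $\ominus:G\to G$ is continuous. A subgyrogroup of $G$ is a nonempty subset $H$ closed under $\oplus$ such that for all $x,y\in H$ the restriction $\mathrm{gyr}[x,y]|_H:H\to\mathrm{gyr}[x,y](H)$ is a bijective homomorphism and $(H,\oplus|_{H\times H})$ is a gyrogroup. For $S\subset G$, $\langle S\rangle$ denotes the smallest subgyrogroup of $G$ containing $S$ (the subgyrogroup generated by $S$). A subset $S$ of a topological gyrogroup $G$ is a suitable set for $G$ if $S$ is discrete in its subspace topology, $\langle S\rangle$ is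 dense in $G$, and $S\cup\{0\}$ is closed in $G$; a closed suitable set is a suitable set that is closed in $G$. *)

(* Defs.v *)
From mathcomp Require Import all_boot.
From mathcomp Require Import all_classical.
From mathcomp Require Import topology.

Set Implicit Arguments.
Unset Strict Implicit.
Unset Printing Implicit Defensive.

Local Open Scope classical_set_scope.

(* [gyr : G * G -> Aut(G, (+))] is curried, so that [gyr x y] is the gyration
   gyr[x, y]; its being an automorphism is [gyr_bij] together with
   [gyr_morph].  The carrier is nonempty because of [gzero]. *)
Record gyrogroup (G : Type) := Gyrogroup {
  gop : G -> G -> G;
  gzero : G;
  gneg : G -> G;
  gyr : G -> G -> G -> G;
  gop0g : forall a, gop gzero a = a;
  gopg0 : forall a, gop a gzero = a;
  gzero_unique : forall e,
    (forall a, gop e a = a /\ gop a e = a) -> e = gzero;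
  gopNg : forall x, gop (gneg x) x = gzero;
  gopgN : forall x, gop x (gneg x) = gzero;
  gneg_unique : forall x y,
    gop y x = gzero -> gop x y = gzero -> y = gneg x;
  gyr_bij : forall x y, bijective (gyr x y);
  gyr_morph : forall x y, {morph gyr x y : a b / gop a b};
  gyr_assoc : forall x y z, gop x (gop y z) = gop (gop x y) (gyr x y z);
  gyr_loop : forall x y, gyr (gop x y) y = gyr x y
}.

Record is_topological_gyrogroup (G : topologicalType) (g : gyrogroup G) :
  Prop := IsTopologicalGyrogroup {
  gop_continuous : continuous (fun p : G * G => gop g p.1 p.2);
  gneg_continuous : continuous (gneg g)
}.

Definition restrict_op (G : Type) (op : G -> G -> G) (H : set G)
    (Hop : forall x y, x \in H -> y \in H -> op x y \in H)
    (x y : set_type H) : set_type H :=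
  exist _ (op (val x) (val y)) (Hop _ _ (valP x) (valP y)).

(* The gyrogroup structure [K] on [H] is only required to have the restricted
   operation; its zero, inverses and gyrations are not prescribed. *)
Record is_subgyrogroup (G : Type) (g : gyrogroup G) (H : set G) : Prop :=
  IsSubgyrogroup {
  sub_nonempty : H !=set0;
  sub_closed : forall x y, x \in H -> y \in H -> gop g x y \in H;
  sub_gyr_bij : forall x y, x \in H -> y \in H ->
    set_bij H (gyr g x y @` H) (gyr g x y);
  sub_gyr_morph : forall x y, x \in H -> y \in H ->
    {in H &, {morph gyr g x y : a b / gop g a b}};
  sub_gyrogroup : exists K : gyrogroup (set_type H),
    gop K = restrict_op sub_closed
}.

Definition generated (G : Type) (g : gyrogroup G) (S : set G) : set G :=
  smallest (is_subgyrogroup g) S.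

(* [set_type S] carries the subspace topology, i.e. the initial topology of
   the inclusion into [G]. *)
Definition discrete_in (G : topologicalType) (S : set G) : Prop :=
  forall B : set (set_type S), open B.

Record is_suitable_set (G : topologicalType) (g : gyrogroup G) (S : set G) :
  Prop := IsSuitableSet {
  suitable_discrete : discrete_in S;
  suitable_dense : dense (generated g S);
  suitable_closed : closed (S `|` [set gzero g])
}.

Definition is_closed_suitable_set (G : topologicalType) (g : gyrogroup G)
    (S : set G) : Prop :=
  is_suitable_set g S /\ closed S.

(* Main.v *)
(* A gyrogroup with an isolated point is discrete, since left translations are
   homeomorphisms.  Otherwise let [W 0 = G] and let [W n] be decreasing nonempty
   open sets such that every point has a neighbourhood missing some [W n]; a
   countable Hausdorff space without isolated points has such a sequence.  A set
   formed by finitely many points chosen in each [W n] is locally finite, hence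
   closed and discrete.  If each [<W n>] is finitely generated over [<W n.+1>],
   then the finite sets can be chosen so that every element of [G] is eventually
   generated.  If not, some open, hence closed, subgyrogroup [L], which with
   finitely many elements generates [G], is the union of a strictly increasing
   sequence [H n] of open subgyrogroups; choosing finitely many points of [L]
   outside [H n], for each [n], again gives a locally finite set. *)

Require Import Defs.
From mathcomp Require Import all_boot.
From mathcomp Require Import all_classical.
From mathcomp Require Import topology.

Set Implicit Arguments.
Unset Strict Implicit.
Unset Printing Implicit Defensive.

Local Open Scope classical_set_scope.

(** * Cancellation laws and generation in gyrogroups *)

Section GyrogroupTheory.
Context {G : Type} (g : gyrogroup G).

Local Notation "x ⊕ y" := (gop g x y) (at level 50, left associativity).
Local Notation "⊖ x" := (gneg g x) (at level 35, right associativity).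

Lemma gop_inj x : injective (gop g x).
Proof.
move=> a b /(congr1 (gop g (⊖ x))); rewrite !gyr_assoc gopNg !gop0g.
exact/ssrfun.bij_inj/gyr_bij.
Qed.

(** The loop property gives gyr[⊖ x, x] = gyr[0, x], and gyr[0, x] is the identity by injectivity of
    left translations. *)
Lemma gopKg x y : ⊖ x ⊕ (x ⊕ y) = y.
Proof.
have gyr0 z : gyr g (gzero g) x z = z.
  by apply: (@gop_inj x); rewrite -{1}(gop0g g x) -gyr_assoc gop0g.
by rewrite gyr_assoc -gyr_loop gopNg gyr0 gop0g.
Qed.

Lemma gnegK x : ⊖ (⊖ x) = x.
Proof. by apply/esym/gneg_unique; rewrite ?gopNg ?gopgN. Qed.

Lemma gopNKg x y : x ⊕ (⊖ x ⊕ y) = y.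
Proof. by have := gopKg (⊖ x) y; rewrite gnegK. Qed.

Lemma gyrE x y z : gyr g x y z = ⊖ (x ⊕ y) ⊕ (x ⊕ (y ⊕ z)).
Proof. by rewrite (gyr_assoc g x y z) gopKg. Qed.

(** A right cancellation law, recovering [x] from [x ⊕ y] and [y]: the loop property turns the
    gyration into gyr[x, y], and associativity applies. *)
Lemma gopgK x y : (x ⊕ y) ⊕ gyr g (x ⊕ y) y (⊖ y) = x.
Proof. by rewrite gyr_loop -gyr_assoc gopgN gopg0. Qed.

(** Closure under gyrations follows, since [gyrE] writes them as words in the operation and the
    inverse. *)
Record subgyro (M : set G) : Prop := Subgyro {
  subgyro0 : M (gzero g);
  subgyroD : forall x y, M x -> M y -> M (x ⊕ y);
  subgyroN : forall x, M x -> M (⊖ x)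
}.

Lemma subgyro_subl M x y : subgyro M -> M x -> M (x ⊕ y) -> M y.
Proof.
by move=> sM Mx Mxy; rewrite -(gopKg x y); apply: subgyroD => //; apply: subgyroN.
Qed.

Lemma subgyro_subr M x y : subgyro M -> M y -> M (x ⊕ y) -> M x.
Proof.
move=> sM My Mxy; rewrite -(gopgK x y) gyrE; move: (x ⊕ y) Mxy => z Mz.
by do ?[exact: Mz | apply: (subgyroD sM) | apply: (subgyroN sM)].
Qed.

(** Left cancellation in [G] identifies the zero and the inverses of [K] with those of [g]. *)
Lemma is_subgyrogroup_subgyro M : is_subgyrogroup g M -> subgyro M.
Proof.
case=> _ MD _ _ [K opK].
have opKE u v : val (gop K u v) = val u ⊕ val v by rewrite opK.
have K0 : val (gzero K) = gzero g.
  by apply: (@gop_inj (val (gzero K))); rewrite -opKE gop0g gopg0.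
split=> [|x y Mx My|x Mx].
- by rewrite -K0; apply: set_valP.
- by apply/set_mem/(MD); apply: mem_set.
- pose u : set_type M := exist _ x (mem_set Mx).
  suff <- : val (gneg K u) = ⊖ x by apply: set_valP.
  by apply: (@gop_inj x); rewrite gopgN -[x]/(val u) -opKE gopgN.
Qed.

Definition span (A : set G) : set G := smallest subgyro A.

Lemma subgyro_span A : subgyro (span A).
Proof.
split=> [M [sM _]|x y Ax Ay M AM|x Ax M AM]; first exact: subgyro0.
- by apply: (subgyroD AM.1); [apply: Ax|apply: Ay].
- by apply: (subgyroN AM.1); apply: Ax.
Qed.

Lemma sub_span A : A `<=` span A.
Proof. exact: sub_gen_smallest. Qed.

Lemma span_min A M : subgyro M -> A `<=` M -> span A `<=` M.
Proof. exact: smallest_sub. Qed.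

Lemma span_mono A B : A `<=` B -> span A `<=` span B.
Proof.
by move=> AB; apply: span_min (subgyro_span _) (subset_trans AB (@sub_span B)).
Qed.

(** Reduces the theorem to finding a suitable [S] whose [span] is all of [G]. *)
Lemma span_sub_generated A : span A `<=` generated g A.
Proof.
move=> x Ax M [/is_subgyrogroup_subgyro sM AM]; exact: span_min Ax.
Qed.

(** The elements having such a [B] form a [subgyro] containing [A]. *)
Lemma span_finite_support A x :
  span A x -> exists B, [/\ finite_set B, B `<=` A & span B x].
Proof.
move: x; apply: span_min => [|x Ax]; last first.
  by exists [set x]; split=> [|_ ->//|]; [exact: finite_set1|exact: sub_span].
split=> [|x y [B [fB BA Bx]] [C [fC CA Cy]]|x [B [fB BA Bx]]].
- by exists set0; split=> //; apply: subgyro0 (subgyro_span _).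
- exists (B `|` C); split; [by rewrite finite_setU|by rewrite subUset|].
  apply: (subgyroD (subgyro_span _)).
  + exact: span_mono Bx.
  + exact: span_mono Cy.
- by exists B; split=> //; apply: (subgyroN (subgyro_span _)).
Qed.

Lemma finite_sub_span A F : finite_set F -> F `<=` span A ->
  exists B, [/\ finite_set B, B `<=` A & F `<=` span B].
Proof.
move=> fF FA.
have /choice[b bP] x :
    exists B, F x -> [/\ finite_set B, B `<=` A & span B x].
  have [Fx|nFx] := pselect (F x); last by exists set0.
  by have [B BP] := span_finite_support (FA _ Fx); exists B.
exists (\bigcup_(x in F) b x); split.
- by apply: bigcup_finite => // x /bP[].
- by apply: bigcup_sub => x /bP[].
- move=> x Fx; have [_ _ bx] := bP x Fx.
  by apply: span_mono bx; apply: bigcup_sup.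
Qed.

End GyrogroupTheory.

Lemma countable_enum (T : Type) (t0 : T) :
  countable [set: T] -> exists e : nat -> T, forall x, exists n, e n = x.
Proof.
move=> /countable_injP[f f_inj].
have /choice[e eP] n : exists y, forall x, f x = n -> y = x.
  have [[x fx]|nfx] := pselect (exists x, f x = n).
    by exists x => y fy; apply: f_inj; rewrite ?inE// fx fy.
  by exists t0 => x fx; case: nfx; exists x.
by exists e => x; exists (f x); apply: eP.
Qed.

(** * Locally finite sets in T1 spaces *)

Definition locally_finite (T : topologicalType) (S : set T) : Prop :=
  forall x, exists U, [/\ open U, U x & finite_set (S `&` U)].

Section LocallyFinite.
Context {T : topologicalType} (T1 : accessible_space T).

Lemma locally_finite_closed (S : set T) : locally_finite S -> closed S.
Proof.
move=> lfS x clSx; have [U [oU Ux fSU]] := lfS x.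
apply: contrapT => nSx.
have oV : open (U `&` ~` (S `&` U)).
  apply: openI => //; apply: closed_openC.
  by move/accessible_finite_set_closed: T1; apply.
have [|y [Sy [Uy nSUy]]] := clSx (U `&` ~` (S `&` U)).
  by apply: open_nbhs_nbhs; split=> //; split=> // -[].
by apply: nSUy.
Qed.

Lemma locally_finite_sub (S S' : set T) :
  S' `<=` S -> locally_finite S -> locally_finite S'.
Proof.
move=> S'S lfS x; have [U [oU Ux fSU]] := lfS x; exists U; split=> //.
by apply: sub_finite_set fSU => y [/S'S].
Qed.

(** Subsets of [S] are again locally finite, hence closed, so [B] is the trace of the open
    complement of [S] minus [B]. *)
Lemma locally_finite_discrete (S : set T) : locally_finite S -> discrete_in S.
Proof.
move=> lfS B; exists (~` (S `\` [set val b | b in B])).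
  apply: closed_openC; apply: locally_finite_closed.
  by apply: locally_finite_sub lfS; apply: subDsetl.
apply/seteqP; split=> [b|b Bb] /=.
  move=> /not_andP[|/contrapT[c Bc /val_inj <-//]].
  by case; apply: set_valP.
by move=> [_]; apply; exists b.
Qed.

End LocallyFinite.

(** * Translations and open subgyrogroups *)

Section TopologicalGyrogroup.
Context {G : topologicalType} {g : gyrogroup G}.
Context (hg : is_topological_gyrogroup g).

Local Notation "x ⊕ y" := (gop g x y) (at level 50, left associativity).
Local Notation "⊖ x" := (gneg g x) (at level 35, right associativity).

Lemma gop_continuousr x : continuous (gop g x).
Proof.
move=> y; have /= c := @gop_continuous _ _ hg (x, y).
by apply: (@continuous2_cvg _ _ _ _ _ _ (fun=> x) id (gop g)) => //; exact: cvg_cst.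
Qed.

Lemma open_translate x (W : set G) : open W -> open [set y | W (x ⊕ y)].
Proof. by apply: open_comp => y _; apply: gop_continuousr. Qed.

Lemma subgyro_open M W : subgyro g M -> open W -> W !=set0 -> W `<=` M -> open M.
Proof.
move=> sM oW [w Ww] WM; rewrite openE => m Mm.
(* The translate of [W] taking [w] to [m] is a neighbourhood of [m] in [M]. *)
apply: (@filterS _ (nbhs m) _ [set y | W (w ⊕ (⊖ m ⊕ y))]).
  move=> y /WM Mwy; apply: (@subgyro_subl _ g _ (⊖ m)) => //.
    exact: (subgyroN sM).
  by apply: (@subgyro_subl _ g _ w) => //; apply: WM.
apply: open_nbhs_nbhs; split; last by rewrite /= gopNg gopg0.
apply: (@open_translate (⊖ m) [set y | W (w ⊕ y)]); exact: open_translate.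
Qed.

(** The neighbourhood x ⊕ M of a closure point [x] meets [M]; right cancellation then puts [x] in
    [M]. *)
Lemma subgyro_closed M : subgyro g M -> open M -> closed M.
Proof.
move=> sM oM x clMx.
have [|y [My Mxy]] := clMx [set y | M (⊖ x ⊕ y)].
  apply: open_nbhs_nbhs; split; first exact: open_translate.
  by rewrite /= gopNg; apply: subgyro0.
by apply: (@subgyro_subr _ g _ _ (⊖ x ⊕ y)) => //; rewrite gopNKg.
Qed.

Lemma isolated_open (x : G) : open [set x] -> forall A : set G, open A.
Proof.
move=> ox A; rewrite openE => y Ay.
apply: (@filterS _ (nbhs y) _ [set z | [set x] (x ⊕ (⊖ y ⊕ z))]).
  move=> z /= xz; suff -> : z = y by [].
  apply: (@gop_inj _ g (⊖ y)); apply: (@gop_inj _ g x).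
  by rewrite xz gopNg gopg0.
apply: open_nbhs_nbhs; split; last by rewrite /= gopNg gopg0.
apply: (@open_translate (⊖ y) [set z | [set x] (x ⊕ z)]); exact: open_translate.
Qed.

Context {e : nat -> G} (e_surj : forall x, exists n, e n = x).

(* [L] is the union of the increasing open subgyrogroups
   [H n = <W, e i : e i in L, i < n>], all proper.  An element [e n] of [L] is
   generated by [x] and [e n + x], both outside [H n.+1] when [x] is. *)
Lemma locally_finite_of_not_fg (W L F : set G) :
  open W -> W !=set0 -> W `<=` L -> subgyro g L ->
  finite_set F -> span g (F `|` L) = [set: G] ->
  ~ (exists B, [/\ finite_set B, B `<=` L & L `<=` span g (B `|` W)]) ->
  exists S : set G, locally_finite S /\ span g S = [set: G].
Proof.
move=> oW W0 WL sL fF FL nfg.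
have oL : open L by apply: subgyro_open W0 WL.
pose B n := L `&` [set e i | i in `I_n].
pose H n := span g (B n `|` W).
have sH n : subgyro g (H n) by apply: subgyro_span.
have oH n : open (H n).
  by apply: (@subgyro_open _ W) => // x Wx; apply: sub_span; right.
have He n i : (i < n)%N -> L (e i) -> H n (e i).
  by move=> ltin Lei; apply: sub_span; left; split=> //; exists i.
have Hmono m n : (m <= n)%N -> H m `<=` H n.
  move=> lemn; apply: span_mono => x [[Lx [i /= ltim eix]]|Wx]; last by right.
  by left; split=> //; exists i => //=; apply: leq_trans lemn.
(* If [H n.+1] contained [L], the finite set [B n.+1] would contradict [nfg]. *)
have /choice[x xP] n : exists x, L x /\ ~ H n.+1 x.
  apply: contrapT => nx; apply: nfg; exists (B n.+1); split.
  - by apply: finite_setIr; apply/finite_image/finite_II.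
  - exact: subIsetl.
  - by move=> y Ly; apply: contrapT => nHy; apply: nx; exists y.
pose P n := [set y | L (e n) /\ (y = x n \/ y = e n ⊕ x n)].
have PH n y : P n y -> L y /\ ~ H n.+1 y.
  have [Lx nHx] := xP n; case=> Len [->//|->]; split; first exact: subgyroD.
  by move/(subgyro_subl (sH _) (He _ _ (ltnSn n) Len)).
exists (F `|` \bigcup_n P n); split=> [z|].
- have [Lz|nLz] := pselect (L z).
  (* The neighbourhood [H n.+1] of [e n] misses [P i] for every i > n. *)
  + have [n enz] := e_surj z; exists (H n.+1); split=> //.
      by rewrite -enz; apply: He; rewrite ?enz.
    apply: (@sub_finite_set _ _ (F `|` \bigcup_(i in `I_n) [set x i; e i ⊕ x i])).
      move=> y [[Fy|[i _ Piy]] Hy]; [by left|right].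
      have [_ nHy] := PH _ _ Piy; exists i; last by case: Piy.
      by rewrite /= ltnNge; apply/negP => leni; apply: nHy; apply: Hmono Hy.
    rewrite finite_setU; split=> //; apply: bigcup_finite; first exact: finite_II.
    by move=> i _; apply: finite_set2.
  + exists (~` L); split=> //; first by apply: closed_openC; apply: subgyro_closed.
    by apply: sub_finite_set fF => y [[//|[n _ /PH[]]]].
- apply/seteqP; split=> // z _.
  have: span g (F `|` L) z by rewrite FL.
  apply: span_min z => [|z [Fz|Lz]]; first exact: subgyro_span.
    by apply: sub_span; left.
  have [n enz] := e_surj z; rewrite -enz in Lz *.
  apply: (@subgyro_subr _ _ _ _ (x n) (subgyro_span _ _)).
    by apply: sub_span; right; exists n => //; split=> //; left.
  by apply: sub_span; right; exists n => //; split=> //; right.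
Qed.

(** * Consequences of having no locally finite generating set *)

Context (no_lf : ~ exists S : set G, locally_finite S /\ span g S = [set: G]).

(** Apply [locally_finite_of_not_fg] to [span g W]; finite supports then trade a finite subset of
    [span g W] for one of [W]. *)
Lemma finite_extension (W W' F : set G) :
  open W' -> W' !=set0 -> W' `<=` W ->
  finite_set F -> span g (F `|` W) = [set: G] ->
  exists B, [/\ finite_set B, B `<=` W & W `<=` span g (B `|` W')].
Proof.
move=> oW' W'0 W'W fF FW; apply: contrapT => nfg; apply: no_lf.
apply: (@locally_finite_of_not_fg W' (span g W) F) => //.
- exact: subset_trans W'W (@sub_span _ _ _).
- exact: subgyro_span.
- apply/seteqP; split=> // x _; have : span g (F `|` W) x by rewrite FW.
  apply: span_mono => y [Fy|Wy]; [by left|by right; apply: sub_span].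
- move=> [C [fC CW WC]]; apply: nfg.
  have [B [fB BW CB]] := finite_sub_span fC CW; exists B; split=> //.
  move=> x /(@sub_span _ g W)/WC; apply: span_min x; first exact: subgyro_span.
  move=> x [/CB|W'x]; first by apply: span_mono => y; left.
  by apply: sub_span; right.
Qed.

Lemma finite_extensionT (W : set G) : open W -> W !=set0 ->
  exists F, finite_set F /\ span g (F `|` W) = [set: G].
Proof.
move=> oW W0.
have T0 : span g (set0 `|` setT) = [set: G].
  by rewrite set0U; apply/seteqP; split=> // x _; apply: sub_span.
have [F [fF _ FT]] := finite_extension oW W0 (@subsetT _ W) (finite_set0 G) T0.
by exists F; split=> //; apply/seteqP; split=> // x /FT.
Qed.

Lemma isolated_of_no_locally_finite : hausdorff_space G -> exists x : G, open [set x].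
Proof.
move=> T2; apply: contrapT => nisol.
(* As [W] is not a single point, it contains some y other than [x]; separate the two. *)
have shrink (W : set G) x : open W -> W !=set0 ->
    exists W' : set G, [/\ open W', W' !=set0, W' `<=` W &
      exists U, [/\ open U, U x & U `&` W' = set0]].
  move=> oW [w Ww]; have [y Wy yx] : exists2 y, W y & y <> x.
    apply: contrapT => nW; apply: nisol; exists w.
    suff -> : [set w] = W by [].
    have Wx z : W z -> z = x.
      by move=> Wz; apply: contrapT => zx; apply: nW; exists z.
    by apply/seteqP; split=> [_ ->//|z Wz] /=; rewrite (Wx z)// (Wx w).
  have := T2; rewrite open_hausdorff => /(_ y x).
  case=> [|[A U] /= [/set_mem Ay /set_mem Ux] [oA oU /eqP AU]]; first exact/eqP.
  exists (W `&` A); split; [exact: openI|by exists y|exact: subIsetl|].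
  exists U; split=> //; apply/seteqP; split=> // z [Uz [_ Az]].
  by rewrite -AU; split.
have /choice[f fP] (p : set G * G) : exists W' : set G,
    open p.1 -> p.1 !=set0 -> [/\ open W', W' !=set0, W' `<=` p.1 &
      exists U, [/\ open U, U p.2 & U `&` W' = set0]].
  have [[oW W0]|nW] := pselect (open p.1 /\ p.1 !=set0).
    by have [W' ?] := shrink p.1 p.2 oW W0; exists W'.
  by exists set0 => oW W0; case: nW.
(* Stage n makes [W n.+1] miss a neighbourhood of [e n]; the enumeration reaches every point. *)
pose W := fix W n := if n is m.+1 then f (W m, e m) else [set: G].
have [oW W0] : (forall n, open (W n)) /\ (forall n, W n !=set0).
  suff oW n : open (W n) /\ W n !=set0 by split=> n; have [] := oW n.
  elim: n => [|n [oW W0]] /=; first by split; [exact: openT|exists (e 0%N)].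
  by have [] := fP (W n, e n) oW W0.
have WS n : W n.+1 `<=` W n by have [] := fP (W n, e n) (oW n) (W0 n).
have eW n : exists U, [/\ open U, U (e n) & U `&` W n.+1 = set0].
  by have [] := fP (W n, e n) (oW n) (W0 n).
have Wmono m n : (m <= n)%N -> W n `<=` W m.
  move=> /subnK <-; elim: (n - m)%N => // k IH.
  exact: subset_trans (WS _) IH.
have /choice[B BP] n : exists B,
    [/\ finite_set B, B `<=` W n & W n `<=` span g (B `|` W n.+1)].
  have [F [fF FW]] := finite_extensionT (oW n) (W0 n).
  exact: finite_extension (oW _) (W0 _) (WS n) fF FW.
have fB n : finite_set (B n) by have [] := BP n.
have BW n : B n `<=` W n by have [] := BP n.
pose A n := \bigcup_(i in `I_n) B i.
(* Inductively, [W n] is traded for [B n] and [W n.+1]. *)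
have AWT n x : span g (A n `|` W n) x.
  elim: n x => [|n IH] x; first by apply: sub_span; right.
  have := IH x; apply: span_min x => [|x]; first exact: subgyro_span.
  case=> [[i /= ltin Bix]|Wnx].
    by apply: sub_span; left; exists i => //=; apply: ltnW.
  have [_ _ /(_ _ Wnx)] := BP n; apply: span_mono => y [Bny|]; last by right.
  by left; exists n => /=.
(* [C n] is the part in [W n] of a finite support of [e n]; the rest lies in [A n]. *)
have /choice[C CP] n : exists C,
    [/\ finite_set C, C `<=` W n & span g (A n `|` C) (e n)].
  have [D [fD DAW De]] := span_finite_support (AWT n (e n)).
  exists (D `&` W n); split; [exact: finite_setIl|exact: subIsetr|].
  apply: span_mono De => x Dx.
  by have [Ax|Wx] := DAW x Dx; [left|right; split].
apply: no_lf; exists (\bigcup_n (B n `|` C n)); split=> [x|].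
  have [n <-] := e_surj x; have [U [oU Uen UW]] := eW n.
  exists U; split=> //.
  apply: (@sub_finite_set _ _ (\bigcup_(i in `I_n.+1) (B i `|` C i))).
    move=> y [[i _ BCy] Uy]; exists i => //=.
    (* For i > n, both [B i] and [C i] lie in [W n.+1], which is disjoint from [U]. *)
    rewrite ltnNge; apply/negP => ltni.
    suff: (U `&` W n.+1) y by rewrite UW.
    split=> //; apply: (Wmono _ _ ltni).
    by have [_ CW _] := CP i; case: BCy => [/BW|/CW].
  apply: bigcup_finite; first exact: finite_II.
  by move=> i _; rewrite finite_setU; split=> //; have [] := CP i.
apply/seteqP; split=> // x _; have [n <-] := e_surj x.
have [_ _] := CP n; apply: span_mono => y [[i _ By]|Cy].
  by exists i => //; left.
by exists n => //; right.
Qed.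

End TopologicalGyrogroup.

Theorem theorem3p3 (G : topologicalType) (g : gyrogroup G)
    (hg : is_topological_gyrogroup g)
    (hG : countable [set: G]) (hT2 : hausdorff_space G) :
  exists S : set G, is_closed_suitable_set g S /\ generated g S = [set: G].
Proof.
have T1 := hausdorff_accessible hT2.
have [e e_surj] := countable_enum (gzero g) hG.
have [S [lfS spanS]] : exists S : set G, locally_finite S /\ span g S = [set: G].
  (* Otherwise an isolated point makes [G] discrete, and then [G] itself is a locally finite
     generating set. *)
  apply: contrapT => no_lf.
  have [x ox] := isolated_of_no_locally_finite hg e_surj no_lf hT2.
  apply: no_lf; exists setT; split=> [y|].
    exists [set y]; split=> //; first exact: (isolated_open hg ox).
    exact: finite_setIr (finite_set1 y).
  by apply/seteqP; split=> // y _; apply: sub_span.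
have genS : generated g S = [set: G].
  by apply/seteqP; split=> // x _; apply: span_sub_generated; rewrite spanS.
exists S; split=> //; split; last exact: locally_finite_closed.
split.
- exact: locally_finite_discrete.
- by move=> O [x Ox] _; exists x; split=> //; rewrite genS.
- apply: closedU; first exact: locally_finite_closed.
  exact: accessible_closed_set1.
Qed.
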